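(* Let $a,b$ be positive integers, $B>1$ an integer, and $z\in\mathbb{C}$ with $|z|\le1$. Define the sequence $(a_k)_{k\ge0}$ by $$\frac{1}{1-x}\sum_{k=0}^{\infty}\frac{x^{bB^k}(1-x^{B^k})}{1-zx^{aB^k}}=\sum_{k=0}^{\infty}a_kx^k .$$ Then $$\gamma_{a,b}(z)=\sum_{k=1}^{\infty}a_kQ(k,B)=\sum_{k=1}^{\infty}a_{\lfloor k/B\rfloor}\frac{\varepsilon(k)}{k}.$$
   Context: $\gamma_{a,b}(z)=\sum_{n=0}^{\infty}\left(\frac{1}{an+b}-\log\frac{an+b+1}{an+b}\right)z^n$ for $|z|\le1$. $Q(k,B)=\sum_{m=1}^{B-1}\frac{m}{Bk(Bk+m)}$. $\varepsilon(n)=B-1$ if $B$ divides $n$, and $\varepsilon(n)=-1$ otherwise. *)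

(* Defs.v *)
From Stdlib Require Import Reals Lra Lia.
From Coquelicot Require Import Coquelicot.
Open Scope R_scope.

(* Coquelicot's [Series] is real-valued; this is its componentwise extension,
   meaningful whenever the complex series converges. *)
Definition CSeries (u : nat -> C) : C :=
  (Series (fun n => Re (u n)), Series (fun n => Im (u n))).

Definition gamma_coeff (a b n : nat) : R :=
  1 / INR (a * n + b) - ln (INR (a * n + b + 1) / INR (a * n + b)).

Definition gamma_term (a b : nat) (z : C) (n : nat) : C :=
  (RtoC (gamma_coeff a b n) * z ^ n)%C.

Definition gamma (a b : nat) (z : C) : C := CSeries (gamma_term a b z).

Definition Q (k B : nat) : R :=
  sum_n_m (fun m => INR m / (INR (B * k) * INR (B * k + m))) 1 (B - 1).

Definition eps (B n : nat) : R :=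
  if Nat.eqb (n mod B) 0 then INR B - 1 else -1.

Definition gen_term (a b B : nat) (z x : C) (k : nat) : C :=
  (x ^ (b * B ^ k) * (1 - x ^ (B ^ k)) / (1 - z * x ^ (a * B ^ k)))%C.

(* [c] is the coefficient sequence of the generating function
   1/(1-x) * sum_k gen_term a b B z x k; the identity on the open unit disc
   determines [c] uniquely. *)
Definition is_gen_seq (a b B : nat) (z : C) (c : nat -> C) : Prop :=
  forall x : C, Cmod x < 1 ->
    exists S : C,
      is_series (gen_term a b B z x) S /\
      is_pseries (V := C_NormedModule) c x (1 / (1 - x) * S)%C.

Lemma is_series_CSeries (u : nat -> C) : ex_series u -> is_series u (CSeries u).
Proof.
intros [l Hl].
assert (HS : forall n, sum_n u n =
          (sum_n (fun k => Re (u k)) n, sum_n (fun k => Im (u k)) n)).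
{ induction n as [|n IH].
  - rewrite !sum_O. now destruct (u O).
  - rewrite !sum_Sn, IH. reflexivity. }
assert (H1 : is_series (fun n => Re (u n)) (Re l)).
{ intros P [e He].
  assert (L : locally l (fun y : C => P (Re y))).
  { apply (locally_le_locally_norm (V := C_NormedModule)).
    exists e. intros y Hy. apply He.
    apply Rle_lt_trans with (2 := Hy).
    apply (Rle_trans _ _ _ (Rmax_l _ _) (Rmax_Cmod (minus y l))). }
  destruct (Hl _ L) as [N HN]. exists N. intros n Hn.
  specialize (HN n Hn). rewrite HS in HN. exact HN. }
assert (H2 : is_series (fun n => Im (u n)) (Im l)).
{ intros P [e He].
  assert (L : locally l (fun y : C => P (Im y))).
  { apply (locally_le_locally_norm (V := C_NormedModule)).
    exists e. intros y Hy. apply He.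
    apply Rle_lt_trans with (2 := Hy).
    apply (Rle_trans _ _ _ (Rmax_r _ _) (Rmax_Cmod (minus y l))). }
  destruct (Hl _ L) as [N HN]. exists N. intros n Hn.
  specialize (HN n Hn). rewrite HS in HN. exact HN. }
unfold CSeries. rewrite (is_series_unique _ _ H1), (is_series_unique _ _ H2).
now destruct l.
Qed.

Lemma gamma_coeff_bound (a b n : nat) : (0 < a)%nat -> (0 < b)%nat ->
  Rabs (gamma_coeff a b n) <= / INR (n + 1) - / INR (n + 2).
Proof.
intros Ha Hb. unfold gamma_coeff.
assert (Hm : (n + 1 <= a * n + b)%nat) by nia.
rewrite (plus_INR (a * n + b) 1).
replace (n + 2)%nat with (n + 1 + 1)%nat by lia. rewrite (plus_INR (n + 1) 1).
apply le_INR in Hm. set (m := INR (a * n + b)) in *.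
assert (Hp : 1 <= INR (n + 1)).
{ rewrite plus_INR. simpl. pose proof (pos_INR n). lra. }
set (p := INR (n + 1)) in *. change (INR 1) with 1.
assert (U : ln ((m + 1) / m) <= 1 / m).
{ replace ((m + 1) / m) with (1 + 1 / m) by (field; lra).
  assert (0 < 1 / m) by (apply Rdiv_lt_0_compat; lra).
  rewrite <- (ln_exp (1 / m)) at 2. apply ln_le; [lra|].
  left. apply exp_ineq1. lra. }
assert (L : / (m + 1) <= ln ((m + 1) / m)).
{ assert (K : ln (m / (m + 1)) <= - / (m + 1)).
  { rewrite <- (ln_exp (- / (m + 1))). apply ln_le.
    - apply Rdiv_lt_0_compat; lra.
    - replace (m / (m + 1)) with (1 + - / (m + 1)) by (field; lra).
      left. apply exp_ineq1.
      assert (0 < / (m + 1)) by (apply Rinv_0_lt_compat; lra). lra. }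
  replace (m / (m + 1)) with (/ ((m + 1) / m)) in K by (field; lra).
  rewrite ln_Rinv in K; [lra|]. apply Rdiv_lt_0_compat; lra. }
rewrite Rabs_pos_eq by lra.
apply Rle_trans with (/ (m * (m + 1))).
{ replace (/ (m * (m + 1))) with (1 / m - / (m + 1)) by (field; lra). lra. }
replace (/ p - / (p + 1)) with (/ (p * (p + 1))) by (field; lra).
apply Rinv_le_contravar; nra.
Qed.

Lemma gamma_correct (a b : nat) (z : C) :
  (0 < a)%nat -> (0 < b)%nat -> Cmod z <= 1 ->
  is_series (gamma_term a b z) (gamma a b z).
Proof.
intros Ha Hb Hz. apply is_series_CSeries.
apply (ex_series_le (V := C_CompleteNormedModule) _
         (fun n => / INR (n + 1) - / INR (n + 2))).
- intros n. change (Cmod (gamma_term a b z n) <= / INR (n + 1) - / INR (n + 2)).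
  unfold gamma_term. rewrite Cmod_mult, Cmod_R, Cmod_pow.
  pose proof (gamma_coeff_bound a b n Ha Hb).
  assert (Cmod z ^ n <= 1).
  { rewrite <- (pow1 n). apply pow_incr. split; [apply Cmod_ge_0|exact Hz]. }
  assert (0 <= Cmod z ^ n) by (apply pow_le, Cmod_ge_0).
  pose proof (Rabs_pos (gamma_coeff a b n)). nra.
- exists 1.
  assert (E : forall n, sum_n (fun k => / INR (k + 1) - / INR (k + 2)) n
                        = 1 - / (INR n + 2)).
  { induction n as [|n IH].
    - rewrite sum_O. simpl. lra.
    - rewrite sum_Sn, IH. change plus with Rplus.
      match goal with |- ?u = ?v => change (@eq R u v) end.
      rewrite !plus_INR, S_INR. pose proof (pos_INR n). simpl INR.
      field; repeat split; lra. }
  change (is_lim_seq (sum_n (fun k => / INR (k + 1) - / INR (k + 2))) 1).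
  apply is_lim_seq_ext with (fun n => 1 - / (INR n + 2)); [now intros; rewrite E|].
  replace (Finite 1) with (Finite (1 - 0)) by (f_equal; ring).
  apply is_lim_seq_minus'; [apply is_lim_seq_const|].
  change (Finite 0) with (Rbar_inv p_infty).
  apply is_lim_seq_inv; [|discriminate].
  eapply is_lim_seq_plus; [apply is_lim_seq_INR|apply is_lim_seq_const|reflexivity].
Qed.

(* Main.v *)
(** Comparing coefficients in the functional equation [F(x) = T(x) + F(x^B)] of
    the series [F] of [gen_term], with [T] its first term, gives [c 0 = 0] and
    [c j = w j + c (j / B)], where [w j] is [z^n] if [j = a n + b] and [0]
    otherwise; in particular [c j = O(sqrt j)].  With
    [g j = 1/j - ln ((j+1)/j) = O(1/j^2)], the logarithms telescope to
    [Q k B = g k - sum_(r < B) g (B k + r)].  The series [sum c_j g_j] converges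
    absolutely, and subtracting from it the series [sum c_(j/B) g_j], grouped in
    blocks of length [B], yields [sum c_k Q(k,B) = sum w_j g_j = gamma].
    The second series is obtained from the first by splitting
    [Q k B = sum_(r < B) eps(B k + r)/(B k + r)], which is legitimate because
    its terms tend to [0]. *)

Require Import Defs.
From Stdlib Require Import Reals Lra Lia Compare_dec PeanoNat.
From Coquelicot Require Import Coquelicot.
Open Scope R_scope.

(* [ring] and [field] do not recognise equations stated over the carrier of a
   Coquelicot structure, such as those produced by [sum_n]. *)
Ltac C_eq := match goal with |- ?u = ?v => change (@eq C u v) end.
Ltac R_eq := match goal with |- ?u = ?v => change (@eq R u v) end.

(** * Series in normed modules *)

Lemma plus_minus_l {G : AbelianGroup} (x y : G) : minus (plus x y) x = y.
Proof.
transitivity (plus y (plus x (opp x))).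
- rewrite plus_assoc. unfold minus. now rewrite (plus_comm x y).
- rewrite plus_opp_r. apply plus_zero_r.
Qed.

Lemma minus_plus_shift {G : AbelianGroup} (x t l : G) :
  minus x l = plus (opp t) (minus (plus x t) l).
Proof.
unfold minus at 2. rewrite (plus_comm x t), !plus_assoc, plus_opp_l.
now rewrite plus_zero_l.
Qed.

Lemma minus_zero {G : AbelianGroup} (x : G) : plus x (opp zero) = x.
Proof. now rewrite opp_zero, plus_zero_r. Qed.

(** Replaces the filter limit by an epsilon-N statement in the norm, the form in which partial sums
    are compared below. *)
Lemma is_series_norm_iff {K : AbsRing} {V : NormedModule K} (u : nat -> V) (l : V) :
  is_series u l <->
  forall eps : posreal, exists N : nat, forall n : nat, (N <= n)%nat ->
    norm (minus (sum_n u n) l) < eps.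
Proof. exact (filterlim_locally_ball_norm (sum_n u) l). Qed.

Lemma is_series_ext_eq {K : AbsRing} {V : NormedModule K} (u v : nat -> V) (l m : V) :
  (forall n, u n = v n) -> l = m -> is_series u l -> is_series v m.
Proof. intros H <-. now apply is_series_ext. Qed.

Lemma is_series_lim_unique {K : AbsRing} {V : NormedModule K} (u : nat -> V) (l m : V) :
  is_series u l -> is_series u m -> l = m.
Proof. exact (filterlim_locally_unique (sum_n u) l m). Qed.

Lemma is_series_shift {K : AbsRing} {V : NormedModule K} (u : nat -> V) (l : V) :
  u O = zero -> is_series u l -> is_series (fun n => u (S n)) l.
Proof. intros H0 H. apply is_series_incr_1. now rewrite H0, plus_zero_r. Qed.

Lemma is_series_unshift {K : AbsRing} {V : NormedModule K} (u : nat -> V) (b : nat) (l : V) :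
  (forall j, (j < b)%nat -> u j = zero) ->
  is_series (fun j => u (b + j)%nat) l -> is_series u l.
Proof.
destruct b as [|b]; intros H0 H; [exact H|].
apply (is_series_decr_n _ (S b)); [lia|].
rewrite (sum_n_ext_loc _ (fun _ => zero)) by (intros; apply H0; simpl in *; lia).
unfold sum_n. rewrite sum_n_m_const_zero.
apply is_series_ext_eq with (3 := H); [reflexivity|].
symmetry. exact (minus_zero l).
Qed.

(** An additive map that does not increase norms is continuous. Two scalar rings are allowed so that
    [Re] and [Im], from a complex to a real module, are covered. *)
Lemma is_series_morphism {K1 K2 : AbsRing} {V1 : NormedModule K1} {V2 : NormedModule K2}
    (f : V1 -> V2) (u : nat -> V1) (l : V1) :
  (forall x y, f (plus x y) = plus (f x) (f y)) ->
  (forall x y, f (minus x y) = minus (f x) (f y)) ->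
  (forall x, norm (f x) <= norm x) ->
  is_series u l -> is_series (fun n => f (u n)) (f l).
Proof.
intros Hp Hm Hn H.
assert (E : forall n, sum_n (fun k => f (u k)) n = f (sum_n u n)).
{ induction n as [|n IH]; [now rewrite !sum_O|]. now rewrite !sum_Sn, IH, Hp. }
apply is_series_norm_iff. intros eps.
destruct (proj1 (is_series_norm_iff u l) H eps) as [N HN].
exists N. intros n Hl. rewrite E, <- Hm.
eapply Rle_lt_trans; [apply Hn|now apply HN].
Qed.

Definition tends_to_0 {K : AbsRing} {V : NormedModule K} (u : nat -> V) : Prop :=
  is_lim_seq (fun n => norm (u n)) 0.

Lemma is_series_tends_to_0 {K : AbsRing} {V : NormedModule K} (u : nat -> V) (l : V) :
  is_series u l -> tends_to_0 u.
Proof.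
intros H. apply is_lim_seq_incr_1, is_lim_seq_spec. intros eps.
destruct (proj1 (is_series_norm_iff u l) H (pos_div_2 eps)) as [N HN].
exists N. intros n Hn. rewrite Rminus_0_r, Rabs_pos_eq by apply norm_ge_0.
assert (E : u (S n) = plus (minus (sum_n u (S n)) l) (opp (minus (sum_n u n) l))).
{ rewrite opp_minus, <- minus_trans, sum_Sn. symmetry.
  exact (plus_minus_l (sum_n u n) (u (S n))). }
pose proof (HN n Hn) as H1. pose proof (HN (S n) ltac:(lia)) as H2.
rewrite E. eapply Rle_lt_trans; [apply norm_triangle|]. rewrite norm_opp.
eapply Rlt_le_trans; [apply Rplus_lt_compat; [exact H2|exact H1]|].
simpl. right. field.
Qed.

(** * Regrouping series: blocks and arithmetic progressions *)

Lemma sum_n_blocks {G : AbelianMonoid} (u : nat -> G) (p n : nat) :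
  sum_n (fun k => sum_n (fun r => u (S p * k + r)%nat) p) n = sum_n u (S p * n + p).
Proof.
assert (E : forall D, sum_n (fun r => u (D + r)%nat) p = sum_n_m u D (D + p)).
{ intros D. induction p as [|p IH].
  - now rewrite sum_O, Nat.add_0_r, sum_n_n.
  - rewrite sum_Sn, IH. replace (D + S p)%nat with (S (D + p)) by lia.
    now rewrite sum_n_Sm by lia. }
induction n as [|n IH].
- rewrite sum_O, E. now rewrite Nat.mul_0_r.
- rewrite sum_Sn, IH, E. unfold sum_n. symmetry.
  rewrite (sum_n_m_Chasles u 0 (S p * n + p) (S p * S n + p)) by lia.
  do 2 f_equal. lia.
Qed.

(** The grouped partial sums are those of [u] at the ends of blocks, hence a subsequence. *)
Lemma is_series_group {K : AbsRing} {V : NormedModule K} (u : nat -> V) (p : nat) (l : V) :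
  is_series u l -> is_series (fun k => sum_n (fun r => u (S p * k + r)%nat) p) l.
Proof.
intros H. apply is_series_norm_iff. intros eps.
destruct (proj1 (is_series_norm_iff u l) H eps) as [N HN].
exists N. intros n Hn. rewrite sum_n_blocks. apply HN. nia.
Qed.

(** A partial sum becomes a grouped one once its last block is completed. This adds at most [p]
    terms, and they are small because the terms tend to 0. *)
Lemma is_series_ungroup {K : AbsRing} {V : NormedModule K} (u : nat -> V) (p : nat) (l : V) :
  tends_to_0 u ->
  is_series (fun k => sum_n (fun r => u (S p * k + r)%nat) p) l -> is_series u l.
Proof.
intros H0 H. apply is_series_norm_iff. intros eps.
destruct (proj1 (is_series_norm_iff _ l) H (pos_div_2 eps)) as [N HN].
assert (Hp : 0 < INR (S p)) by (apply lt_0_INR; lia).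
assert (He : 0 < eps / 2 / INR (S p)).
{ pose proof (cond_pos eps). apply Rdiv_lt_0_compat; lra. }
apply is_lim_seq_spec in H0.
destruct (H0 (mkposreal _ He)) as [M HM]. simpl in HM.
(* Past [M] each term has norm below [eps / 2 / S p]; past [S p * N] the block index is at least
   [N]. *)
exists (M + S p * N)%nat. intros n Hn.
pose proof (Nat.div_mod_eq n (S p)) as Hd.
pose proof (Nat.mod_upper_bound n (S p) ltac:(lia)) as Hr.
set (k := (n / S p)%nat) in *. set (r := (n mod S p)%nat) in *.
assert (Hk : (N <= k)%nat) by nia.
specialize (HN k Hk). rewrite sum_n_blocks in HN. simpl pos in HN.
assert (Hc : sum_n u (S p * k + p) =
             plus (sum_n u n) (sum_n_m u (S n) (S p * k + p))).
{ apply sum_n_m_Chasles; nia. }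
set (t := sum_n_m u (S n) (S p * k + p)) in *.
assert (Ht : norm t <= eps / 2).
{ apply Rle_trans with (1 := norm_sum_n_m _ _ _).
  apply Rle_trans with (sum_n_m (fun _ => eps / 2 / INR (S p)) (S n) (S p * k + p)).
  - destruct (le_lt_dec (S n) (S p * k + p)) as [Hl|Hl].
    2:{ rewrite !sum_n_m_zero by lia. apply Rle_refl. }
    (* [sum_n_m_le] wants its inequality at every index, but the bound holds only from [M] on; the
       minimum satisfies it everywhere and agrees with the norm on the range. *)
    rewrite (sum_n_m_ext_loc _ (fun j => Rmin (norm (u j)) (eps / 2 / INR (S p)))).
    + apply sum_n_m_le. intros j. apply Rmin_r.
    + intros j Hj. symmetry. apply Rmin_left.
      specialize (HM j ltac:(lia)). rewrite Rminus_0_r, Rabs_pos_eq in HM by apply norm_ge_0.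
      now apply Rlt_le.
  - rewrite sum_n_m_const.
    apply Rle_trans with (INR (S p) * (eps / 2 / INR (S p))).
    + apply Rmult_le_compat_r; [lra|]. apply le_INR. lia.
    + right. field. lra. }
replace (minus (sum_n u n) l) with (plus (opp t) (minus (sum_n u (S p * k + p)) l))
  by (rewrite Hc; symmetry; exact (minus_plus_shift (sum_n u n) t l)).
eapply Rle_lt_trans; [apply norm_triangle|]. rewrite norm_opp.
eapply Rlt_le_trans; [apply Rplus_le_lt_compat; [exact Ht|exact HN]|].
right. field.
Qed.

(* [spread d a b f (a * n + b) = f n], and [d] off this progression. *)
Definition spread {T : Type} (d : T) (a b : nat) (f : nat -> T) (j : nat) : T :=
  if andb (b <=? j)%nat ((j - b) mod a =? 0)%nat then f ((j - b) / a)%nat else d.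

(** Lets a factor depending on the position, such as [x ^ j], move inside [spread], where the
    position is [a * n + b]. *)
Lemma spread_map {T U : Type} (d : T) (e : U) (h : nat -> T -> U) (a b : nat) f j :
  (0 < a)%nat -> h j d = e ->
  h j (spread d a b f j) = spread e a b (fun n => h (a * n + b)%nat (f n)) j.
Proof.
intros Ha He. unfold spread.
destruct (Nat.leb_spec b j) as [Hb|]; [|exact He]. simpl.
destruct (Nat.eqb_spec ((j - b) mod a) 0) as [Hm|]; [|exact He].
f_equal. pose proof (Nat.div_mod_eq (j - b) a). lia.
Qed.

(** After the first [b] zeros, each block of length [a] holds one term of [u] at its start and zeros
    elsewhere, so ungrouping applies. *)
Lemma is_series_spread {K : AbsRing} {V : NormedModule K} (u : nat -> V) (a b : nat) (l : V) :
  (0 < a)%nat -> is_series u l -> is_series (spread zero a b u) l.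
Proof.
intros Ha H.
assert (H1 : is_series (fun j => spread zero a b u (b + j)%nat) l).
{ assert (E : forall j, spread zero a b u (b + j)%nat =
     if (j mod a =? 0)%nat then u (j / a)%nat else zero).
  { intros j. unfold spread. replace (b + j - b)%nat with j by lia.
    now rewrite (proj2 (Nat.leb_le b (b + j)) ltac:(lia)). }
  destruct a as [|p]; [lia|].
  apply (is_series_ext (fun j => if (j mod S p =? 0)%nat then u (j / S p)%nat else zero));
    [now intros; rewrite E|].
  apply (is_series_ungroup _ p).
  - apply is_series_tends_to_0 in H. apply is_lim_seq_spec in H. apply is_lim_seq_spec.
    intros eps. destruct (H eps) as [N HN]. exists (S p * N)%nat. intros n Hn.
    destruct (_ =? _)%nat.
    + apply HN. apply Nat.div_le_lower_bound; lia.
    + rewrite norm_zero, Rminus_0_r, Rabs_R0. apply cond_pos.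
  - apply is_series_ext with (2 := H). intros k.
    assert (F : forall q, (q <= p)%nat -> u k = sum_n (fun r =>
      if ((S p * k + r) mod S p =? 0)%nat then u ((S p * k + r) / S p)%nat else zero) q);
      [|now apply F].
    induction q as [|q IH]; intros Hq.
    + rewrite sum_O, Nat.add_0_r, (Nat.mul_comm (S p)).
      now rewrite Nat.Div0.mod_mul, Nat.div_mul by lia.
    + rewrite sum_Sn, <- IH by lia.
      rewrite (Nat.add_comm (S p * k)), (Nat.mul_comm (S p)), Nat.Div0.mod_add.
      rewrite Nat.mod_small by lia. simpl. now rewrite plus_zero_r. }
apply (is_series_unshift _ b); [|exact H1].
intros j Hj. unfold spread. now rewrite (proj2 (Nat.leb_gt b j)).
Qed.

(** * Complex series, the geometric series and uniqueness of power series *)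

Lemma is_pseries_C_iff (c : nat -> C) (x l : C) :
  is_pseries (V := C_NormedModule) c x l <-> is_series (fun n => x ^ n * c n)%C l.
Proof.
assert (E : forall n, pow_n (K := C_AbsRing) x n = (x ^ n)%C).
{ induction n as [|n IH]; [reflexivity|]. simpl. now rewrite IH. }
split; apply is_series_ext; intros n; rewrite <- (E n); reflexivity.
Qed.

Lemma is_series_Re (u : nat -> C) (l : C) :
  is_series u l -> is_series (fun n => Re (u n)) (Re l).
Proof.
apply (is_series_morphism (V1 := C_NormedModule) (V2 := R_NormedModule) Re);
  [reflexivity|reflexivity|].
intros x. apply (Rle_trans _ _ _ (Rmax_l _ _) (Rmax_Cmod x)).
Qed.

Lemma is_series_Im (u : nat -> C) (l : C) :
  is_series u l -> is_series (fun n => Im (u n)) (Im l).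
Proof.
apply (is_series_morphism (V1 := C_NormedModule) (V2 := R_NormedModule) Im);
  [reflexivity|reflexivity|].
intros x. apply (Rle_trans _ _ _ (Rmax_r _ _) (Rmax_Cmod x)).
Qed.

Lemma is_series_Cscal (q : C) (u : nat -> C) (l : C) :
  is_series u l -> is_series (fun n => q * u n)%C (q * l)%C.
Proof. exact (is_series_scal (V := C_NormedModule) q u l). Qed.

Lemma is_series_Cminus (u v : nat -> C) (l m : C) :
  is_series u l -> is_series v m -> is_series (fun n => u n - v n)%C (l - m)%C.
Proof. exact (is_series_minus (V := C_NormedModule) u v l m). Qed.

Lemma one_minus_neq_0 (q : C) : Cmod q < 1 -> (1 - q)%C <> RtoC 0.
Proof.
intros Hq E. assert (q = RtoC 1) as -> by (rewrite <- (Cplus_0_l q), <- E; ring).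
rewrite Cmod_1 in Hq. lra.
Qed.

Lemma is_series_Cgeom (q : C) :
  Cmod q < 1 -> is_series (fun n => q ^ n)%C (/ (1 - q))%C.
Proof.
intros Hq.
pose proof (one_minus_neq_0 q Hq) as H1.
apply (is_series_norm_iff (V := C_NormedModule)). intros eps.
assert (Hm : 0 < Cmod (1 - q)) by now apply Cmod_gt_0.
assert (H := is_lim_seq_geom (Cmod q)). rewrite Rabs_pos_eq in H by apply Cmod_ge_0.
specialize (H Hq). apply is_lim_seq_incr_1, is_lim_seq_spec in H.
(* The remainder is [- q ^ S n / (1 - q)], so the factor [Cmod (1 - q)] absorbs the denominator. *)
destruct (H (mkposreal _ (Rmult_lt_0_compat _ _ (cond_pos eps) Hm))) as [N HN].
exists N. intros n Hn. specialize (HN n Hn).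
rewrite Rminus_0_r, <- Cmod_pow, Rabs_pos_eq in HN by apply Cmod_ge_0.
change (Cmod (q ^ S n) < eps * Cmod (1 - q)) in HN.
assert (E : forall n, minus (sum_n (fun n => q ^ n)%C n : C) (/ (1 - q))%C
            = (- (q ^ S n / (1 - q)))%C).
{ intros m. assert (F : sum_n (fun n => q ^ n)%C m = ((1 - q ^ S m) / (1 - q))%C).
  { induction m as [|m IH].
    - rewrite sum_O. simpl. C_eq. now field.
    - rewrite sum_Sn, IH. change plus with Cplus. simpl. C_eq. now field. }
  rewrite F. change minus with Cminus. C_eq. now field. }
rewrite E. change (Cmod (- (q ^ S n / (1 - q))) < eps).
rewrite Cmod_opp, Cmod_div by assumption.
apply Rmult_lt_reg_r with (1 := Hm). unfold Rdiv.
rewrite Rmult_assoc, Rinv_l by lra. lra.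
Qed.

Lemma pseries_R_zero (d : nat -> R) :
  (forall x : R, Rabs x < 1 -> is_series (fun n => x ^ n * d n) 0) ->
  forall n, d n = 0.
Proof.
intros H n.
assert (HP : forall x : R, Rabs x < 1 -> is_pseries d x 0).
{ intros x Hx. apply (is_series_ext _ _ _ (fun k => eq_refl)) with (1 := H x Hx). }
change (d n = (fun _ => 0) n). apply PSeries_ext_recip.
(* The radius is positive: otherwise the terms at [1 / 2] could not tend to 0, although the series
   converges there. *)
- destruct (Rbar_lt_le_dec 0 (CV_radius d)) as [Hl|Hl]; [exact Hl|exfalso].
  apply (CV_disk_outside d (1 / 2)).
  + apply Rbar_le_lt_trans with (1 := Hl). simpl. rewrite Rabs_pos_eq; lra.
  + apply is_lim_seq_ext with (fun n => (1 / 2) ^ n * d n); [intros; ring|].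
    apply ex_series_lim_0. exists 0. apply H. rewrite Rabs_pos_eq; lra.
- rewrite CV_radius_const_0. exact I.
- exists (mkposreal 1 Rlt_0_1). intros x Hx.
  change (Rabs (x - 0) < 1) in Hx. rewrite Rminus_0_r in Hx.
  rewrite PSeries_const_0. apply is_pseries_unique. now apply HP.
Qed.

(** Real [x] suffice: there the real and imaginary parts are themselves real power series. *)
Lemma pseries_C_zero (d : nat -> C) :
  (forall x : C, Cmod x < 1 -> is_series (fun n => x ^ n * d n)%C (RtoC 0)) ->
  forall n, d n = RtoC 0.
Proof.
intros H n.
assert (HR : forall x : R, Rabs x < 1 ->
  is_series (fun n => RtoC (x ^ n) * d n)%C (RtoC 0)).
{ intros x Hx. apply (is_series_ext (fun n => RtoC x ^ n * d n)%C).
  - intros k. now rewrite RtoC_pow.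
  - apply H. now rewrite Cmod_R. }
rewrite (surjective_pairing (d n)). unfold RtoC. f_equal.
- apply (pseries_R_zero (fun n => Re (d n))). intros x Hx.
  apply is_series_ext with (2 := is_series_Re _ _ (HR x Hx)).
  intros k. unfold Re. simpl. ring.
- apply (pseries_R_zero (fun n => Im (d n))). intros x Hx.
  apply is_series_ext with (2 := is_series_Im _ _ (HR x Hx)).
  intros k. unfold Im. simpl. ring.
Qed.

(** * Generating functions and the recursion for the coefficients *)

Lemma Cpow_le_1 (z : C) (n : nat) : Cmod z <= 1 -> Cmod (z ^ n) <= 1.
Proof.
intros Hz. rewrite Cmod_pow, <- (pow1 n). apply pow_incr.
split; [apply Cmod_ge_0|exact Hz].
Qed.

Lemma Cpow_lt_1 (x : C) (n : nat) : (0 < n)%nat -> Cmod x < 1 -> Cmod (x ^ n) < 1.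
Proof.
intros Hn Hx. destruct n as [|n]; [lia|]. simpl. rewrite Cmod_mult.
pose proof (Cpow_le_1 x n ltac:(lra)). pose proof (Cmod_ge_0 x).
pose proof (Cmod_ge_0 (x ^ n)). nra.
Qed.

(** Expand the geometric series in [z * x ^ a], multiply by [x ^ b], and put the term with
    [x ^ (a * n + b)] at its own exponent. *)
Lemma is_series_spread_pow (a b : nat) (z x : C) :
  (0 < a)%nat -> Cmod z <= 1 -> Cmod x < 1 ->
  is_series (fun j => x ^ j * spread (RtoC 0) a b (fun n => z ^ n) j)%C
            (x ^ b / (1 - z * x ^ a))%C.
Proof.
intros Ha Hz Hx.
assert (Hq : Cmod (z * x ^ a) < 1).
{ rewrite Cmod_mult. pose proof (Cpow_lt_1 x a Ha Hx). pose proof (Cmod_ge_0 z).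
  pose proof (Cmod_ge_0 (x ^ a)). nra. }
assert (H := is_series_Cscal (x ^ b) _ _ (is_series_Cgeom _ Hq)).
apply (is_series_spread (V := C_NormedModule) _ a b _ Ha) in H.
apply is_series_ext with (2 := H). intros j.
rewrite (spread_map (RtoC 0) (RtoC 0) (fun j y => x ^ j * y)%C) by (trivial; ring).
unfold spread. destruct (andb _ _); [|reflexivity].
rewrite Cpow_mult_l, Cpow_add_r, Cpow_mult_r. C_eq. ring.
Qed.

(** A block of [S p] equal coefficients contributes the finite geometric sum
    [(1 - x ^ S p) / (1 - x)]. *)
Lemma is_series_block_pow (c : nat -> C) (p : nat) (x l : C) : Cmod x < 1 ->
  is_series (fun n => (x ^ S p) ^ n * c n)%C l ->
  is_series (fun n => x ^ n * c (n / S p)%nat)%C ((1 - x ^ S p) / (1 - x) * l)%C.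
Proof.
intros Hx H.
assert (Hd : forall k r, (r <= p)%nat -> ((S p * k + r) / S p = k)%nat).
{ intros k r Hr. symmetry. apply Nat.div_unique with r; lia. }
apply (is_series_ungroup (V := C_NormedModule) _ p).
- assert (H0 := is_series_tends_to_0 (V := C_NormedModule) _ _ H).
  apply is_lim_seq_spec in H0. apply is_lim_seq_spec. intros eps.
  destruct (H0 eps) as [N HN]. exists (S p * N)%nat. intros n Hn.
  specialize (HN (n / S p)%nat ltac:(apply Nat.div_le_lower_bound; lia)).
  rewrite Rminus_0_r, Rabs_pos_eq in * by apply norm_ge_0.
  apply Rle_lt_trans with (2 := HN).
  change (Cmod (x ^ n * c (n / S p)%nat) <=
          Cmod ((x ^ S p) ^ (n / S p) * c (n / S p)%nat)).
  rewrite !Cmod_mult. apply Rmult_le_compat_r; [apply Cmod_ge_0|].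
  (* The power [x ^ n] differs from [(x ^ S p) ^ (n / S p)] by a factor of modulus at most 1. *)
  rewrite (Nat.div_mod_eq n (S p)) at 1. rewrite Cpow_add_r, Cpow_mult_r, Cmod_mult.
  pose proof (Cpow_le_1 x (n mod S p) ltac:(lra)).
  pose proof (Cmod_ge_0 ((x ^ S p) ^ (n / S p))). nra.
- apply is_series_ext with (2 := is_series_Cscal ((1 - x ^ S p) / (1 - x)) _ _ H).
  intros k. pose proof (one_minus_neq_0 x Hx) as H1.
  transitivity (sum_n (fun r => (x ^ S p) ^ k * c k * x ^ r)%C p).
  + assert (E : forall q, sum_n (fun r => (x ^ S p) ^ k * c k * x ^ r)%C q =
      ((x ^ S p) ^ k * c k * ((1 - x ^ S q) / (1 - x)))%C); [|rewrite E; C_eq; ring].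
    induction q as [|q IH]; [rewrite sum_O; simpl; C_eq; now field|].
    rewrite sum_Sn, IH. change plus with Cplus. simpl. C_eq. now field.
  + apply sum_n_ext_loc. intros r Hr. rewrite Hd by exact Hr.
    rewrite Cpow_add_r, (Cpow_mult_r x (S p) k). C_eq. ring.
Qed.

(** With [C(x) = F(x) / (1 - x)] and [B = S p], the functional equation reads [C(x) = x^b / (1 - z
    x^a) + (1 - x^B) / (1 - x) * C(x^B)]; coefficients are then compared. At [j = 0] the recursion
    leaves [c 0] free, so it is found separately by setting [x = 0]. *)
Lemma gen_seq_rec (a b p : nat) (z : C) (c : nat -> C) :
  (0 < a)%nat -> (0 < b)%nat -> Cmod z <= 1 -> is_gen_seq a b (S p) z c ->
  c O = RtoC 0 /\
  forall j, c j = (spread (RtoC 0) a b (fun n => z ^ n)%C j + c (j / S p)%nat)%C.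
Proof.
intros Ha Hb Hz Hc. split.
- destruct (Hc (RtoC 0)) as [s [Hs H]]; [rewrite Cmod_0; lra|].
  assert (P0 : forall n, (0 < n)%nat -> (RtoC 0 ^ n)%C = RtoC 0).
  { intros [|n] Hn; [lia|]. simpl. ring. }
  assert (Es : s = RtoC 0).
  { apply (is_series_lim_unique (V := C_NormedModule) _ _ _ Hs).
    apply is_series_ext_eq with (3 := is_series_Cscal (RtoC 0) _ _ Hs); [|C_eq; ring].
    intros k. unfold gen_term. rewrite P0; [unfold Cdiv; C_eq; ring|].
    apply Nat.mul_pos_pos; [lia|]. apply Nat.neq_0_lt_0, Nat.pow_nonzero. lia. }
  apply (proj1 (is_pseries_C_iff _ _ _)) in H. rewrite Es in H.
  apply (is_series_lim_unique (V := C_NormedModule) (fun n => RtoC 0 ^ n * c n)%C).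
  (* As [0 ^ 0 = 1], only the constant term [c 0] survives at [x = 0]. *)
  + apply (is_series_decr_1 (V := C_NormedModule)).
    apply is_series_ext_eq with (3 := is_series_Cscal (RtoC 0) _ _ H).
    * intros k. simpl. C_eq. ring.
    * change plus with Cplus. change opp with Copp. simpl. C_eq. ring.
  + apply is_series_ext_eq with (3 := H); [reflexivity|]. unfold Cdiv. C_eq. ring.
- intros j.
  set (w := spread (RtoC 0) a b (fun n => z ^ n)%C).
  enough (E : (c j - w j - c (j / S p)%nat)%C = RtoC 0).
  { rewrite <- (Cplus_0_r (w j + _)), <- E. ring. }
  apply (pseries_C_zero (fun j => c j - w j - c (j / S p)%nat)%C). clear j. intros x Hx.
  pose proof (Cpow_lt_1 x (S p) ltac:(lia) Hx) as Hy.
  destruct (Hc x Hx) as [s [Hs H]]. apply (proj1 (is_pseries_C_iff _ _ _)) in H.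
  destruct (Hc _ Hy) as [t [Ht H']]. apply (proj1 (is_pseries_C_iff _ _ _)) in H'.
  apply (is_series_block_pow c p x _ Hx) in H'.
  pose proof (is_series_spread_pow a b z x Ha Hz Hx) as Hw. fold w in Hw.
  (* Term [k + 1] at [x] is term [k] at [x ^ S p]. *)
  assert (Et : s = (gen_term a b (S p) z x 0 + t)%C).
  { apply (is_series_lim_unique (V := C_NormedModule) _ _ _ Hs).
    apply (is_series_decr_1 (V := C_NormedModule)).
    apply is_series_ext_eq with (3 := Ht).
    - intros k. unfold gen_term.
      rewrite !(Nat.mul_comm _ (S p ^ S k)), !Nat.pow_succ_r', <- !Nat.mul_assoc.
      rewrite !(Nat.mul_comm (S p ^ k)). now rewrite !(Cpow_mult_r x (S p)).
    - change plus with Cplus. change opp with Copp. C_eq. ring. }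
  apply is_series_ext_eq with
    (3 := is_series_Cminus _ _ _ _ (is_series_Cminus _ _ _ _ H Hw) H').
  + intros k. C_eq. ring.
  + rewrite Et. unfold gen_term. rewrite Nat.pow_0_r, !Nat.mul_1_r.
    pose proof (one_minus_neq_0 x Hx). pose proof (one_minus_neq_0 _ Hy).
    assert ((1 - z * x ^ a)%C <> RtoC 0).
    { apply one_minus_neq_0. rewrite Cmod_mult. pose proof (Cpow_lt_1 x a Ha Hx).
      pose proof (Cmod_ge_0 z). pose proof (Cmod_ge_0 (x ^ a)). nra. }
    C_eq. simpl Cpow at 2. field. auto.
Qed.

(** * Growth of the coefficients and convergence against the logarithmic gaps *)

(** The recursion ends after about [log j / log B] steps, so the growth is in fact logarithmic; a
    square root is cruder but leads to a telescoping majorant. The constant 4 solves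
    [1 + 3 / 4 * K = K]. *)
Lemma Cmod_rec_bound (c w : nat -> C) (B : nat) : (1 < B)%nat ->
  c O = RtoC 0 -> (forall j, Cmod (w j) <= 1) ->
  (forall j, c j = (w j + c (j / B)%nat)%C) ->
  forall j, Cmod (c j) <= 4 * sqrt (INR j).
Proof.
intros HB H0 Hw Hc j. induction j as [j IH] using (well_founded_induction Nat.lt_wf_0).
destruct (Nat.eq_dec j 0) as [->|Hj].
{ rewrite H0, Cmod_0. pose proof (sqrt_pos (INR 0)). lra. }
assert (Hlt : (j / B < j)%nat) by (apply Nat.div_lt; lia).
assert (H2 : 2 * INR (j / B) <= INR j).
{ change 2 with (INR 2). rewrite <- mult_INR. apply le_INR.
  pose proof (Nat.Div0.mul_div_le j B). nia. }
rewrite Hc. apply Rle_trans with (1 := Cmod_triangle _ _).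
assert (H1 : 1 <= INR j) by (change 1 with (INR 1); apply le_INR; lia).
assert (Hs : 1 <= sqrt (INR j)) by (rewrite <- sqrt_1; apply sqrt_le_1_alt; exact H1).
(* Here [3 / 4] is a rational upper bound for [sqrt (1 / 2)]. *)
assert (sqrt (INR (j / B)) <= 3 / 4 * sqrt (INR j)).
{ replace (3 / 4) with (sqrt (3 / 4 * (3 / 4))) by (apply sqrt_square; lra).
  rewrite <- sqrt_mult by lra. apply sqrt_le_1_alt. lra. }
specialize (IH _ Hlt). specialize (Hw j). lra.
Qed.

Lemma ex_series_telescope (f : nat -> R) (l : R) : is_lim_seq f l ->
  ex_series (fun n => f n - f (S n)).
Proof.
intros H. exists (f O - l).
change (is_lim_seq (sum_n (fun n => f n - f (S n))) (f O - l)).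
apply is_lim_seq_ext with (fun n => f O - f (S n)).
- induction n as [|n IH]; [now rewrite sum_O|].
  rewrite sum_Sn, <- IH. change plus with Rplus.
  R_eq. ring.
- apply is_lim_seq_minus'; [apply is_lim_seq_const|now apply is_lim_seq_incr_1 in H].
Qed.

Lemma is_lim_seq_inv_sqrt : is_lim_seq (fun n => / sqrt (INR n)) 0.
Proof.
change (Finite 0) with (Rbar_inv p_infty).
apply is_lim_seq_inv; [|discriminate].
apply (filterlim_comp _ _ _ INR sqrt _ (Rbar_locally p_infty)).
- apply is_lim_seq_INR.
- exact filterlim_sqrt_p.
Qed.

(** The sequence [g] of the outline; [gamma_coeff a b n] is its value at [a * n + b]. The value at 0
    rests on a division by zero and is later multiplied by a zero coefficient. *)
Definition log_gap (j : nat) : R := 1 / INR j - ln (INR (j + 1) / INR j).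

Lemma log_gap_bound (n : nat) : Rabs (log_gap (S n)) <= / INR (S n) - / INR (S (S n)).
Proof.
pose proof (gamma_coeff_bound 1 1 n Nat.lt_0_1 Nat.lt_0_1) as H.
unfold gamma_coeff in H. rewrite Nat.mul_1_l, Nat.add_1_r in H.
replace (n + 2)%nat with (S (S n)) in H by lia. exact H.
Qed.

(** The bound [4 sqrt j * (1 / j - 1 / (j + 1))] is at most [8 (1 / sqrt j - 1 / sqrt (j + 1))],
    which telescopes. *)
Lemma ex_series_log_gap (c : nat -> C) :
  (forall j, Cmod (c j) <= 4 * sqrt (INR j)) ->
  ex_series (fun j => c j * RtoC (log_gap j))%C.
Proof.
intros Hc. apply (ex_series_incr_1 (V := C_NormedModule)).
apply (ex_series_le (V := C_CompleteNormedModule) _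
        (fun n => 8 * (/ sqrt (INR (S n)) - / sqrt (INR (S (S n)))))).
- intros n. change (Cmod (c (S n) * RtoC (log_gap (S n))) <=
    8 * (/ sqrt (INR (S n)) - / sqrt (INR (S (S n))))).
  rewrite Cmod_mult, Cmod_R.
  pose proof (Hc (S n)) as H1. pose proof (log_gap_bound n) as H2.
  set (x := INR (S n)) in *. set (y := INR (S (S n))) in *.
  assert (Hx : 0 < x) by (apply lt_0_INR; lia).
  assert (Hxy : x < y) by (apply lt_INR; lia).
  assert (Hs : 0 < sqrt x) by now apply sqrt_lt_R0.
  assert (Hst : sqrt x < sqrt y) by (apply sqrt_lt_1_alt; lra).
  apply Rle_trans with (4 * sqrt x * (/ x - / y)).
  { apply Rmult_le_compat; [apply Cmod_ge_0|apply Rabs_pos|exact H1|exact H2]. }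
  assert (Ex : x = sqrt x * sqrt x) by (symmetry; apply sqrt_sqrt; lra).
  assert (Ey : y = sqrt y * sqrt y) by (symmetry; apply sqrt_sqrt; lra).
  set (s := sqrt x) in *. set (t := sqrt y) in *. rewrite Ex, Ey.
  clearbody s t. apply Rminus_le.
  (* In the roots [s < t] the inequality reduces to [s + t <= 2 t]; the difference of its sides is
     minus a square times a positive factor. *)
  replace (_ - _) with (- (4 * (t - s) * (t - s) * / (s * t * t))) by (field; lra).
  assert (0 < / (s * t * t)) by (apply Rinv_0_lt_compat; repeat apply Rmult_lt_0_compat; lra).
  pose proof (Rle_0_sqr (t - s)). unfold Rsqr in *. nra.
- apply (ex_series_scal_l (V := R_NormedModule) 8).
  apply (ex_series_telescope (fun n => / sqrt (INR (S n))) 0).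
  apply (is_lim_seq_incr_1 (fun n => / sqrt (INR n))), is_lim_seq_inv_sqrt.
Qed.

(** * The rational sums [Q k B] as block sums *)

(** The logarithms telescope, and [1 / (D + r) = 1 / D - r / (D (D + r))]. *)
Lemma log_gap_block (D q : nat) : (0 < D)%nat ->
  sum_n (fun r => log_gap (D + r)) q =
  INR (S q) / INR D - ln (INR (D + S q) / INR D)
  - sum_n_m (fun m => INR m / (INR D * INR (D + m))) 1 q.
Proof.
intros HD. assert (Hp : forall r, 0 < INR (D + r)) by (intros; apply lt_0_INR; lia).
assert (HD' : 0 < INR D) by now apply lt_0_INR.
induction q as [|q IH].
- rewrite sum_O, sum_n_m_zero by lia. change zero with 0.
  unfold log_gap. rewrite Nat.add_0_r. change (INR 1) with 1. R_eq. ring.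
- rewrite sum_Sn, IH, sum_n_Sm by lia. change plus with Rplus.
  unfold log_gap. replace (D + S q + 1)%nat with (D + S (S q))%nat by lia.
  rewrite !ln_div by trivial.
  replace (1 / INR (D + S q)) with
    (1 / INR D - INR (S q) / (INR D * INR (D + S q))).
  2:{ pose proof (Hp (S q)). rewrite plus_INR in *. field. lra. }
  rewrite (S_INR (S q)).
  pose proof (Hp (S q)). R_eq. field. lra.
Qed.

(** For a full block at [D = B k], the main terms [B / D] and [ln ((D + B) / D)] reduce to [1 / k]
    and [ln ((k + 1) / k)], that is, to [log_gap k]. *)
Lemma Q_log_gap (k p : nat) : (0 < k)%nat ->
  Q k (S p) = log_gap k - sum_n (fun r => log_gap (S p * k + r)) p.
Proof.
intros Hk. rewrite log_gap_block by lia. unfold Q, log_gap.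
replace (S p - 1)%nat with p by lia.
replace (S p * k + S p)%nat with (S p * (k + 1))%nat by lia.
rewrite !(mult_INR (S p)).
assert (0 < INR (S p)) by (apply lt_0_INR; lia).
assert (0 < INR k) by now apply lt_0_INR.
replace (INR (S p) * INR (k + 1) / (INR (S p) * INR k)) with (INR (k + 1) / INR k)
  by (field; lra).
replace (INR (S p) / (INR (S p) * INR k)) with (1 / INR k) by (field; lra).
R_eq. symmetry; R_eq; ring.
Qed.

(** Since [m / (D (D + m)) = 1 / D - 1 / (D + m)], the [B - 1] copies of [1 / D] at the start of the
    block pair off with the remaining terms. *)
Lemma Q_eps_block (k p : nat) : (0 < k)%nat ->
  sum_n (fun r => eps (S p) (S p * k + r) / INR (S p * k + r)) p = Q k (S p).
Proof.
intros Hk. set (D := (S p * k)%nat).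
assert (HD : 0 < INR D) by (apply lt_0_INR; unfold D; lia).
(* After [q] pairings, [p - q] copies of [1 / D] are left. *)
assert (E : forall q, (q <= p)%nat ->
  sum_n (fun r => eps (S p) (D + r) / INR (D + r)) q =
  INR (p - q) / INR D + sum_n_m (fun m => INR m / (INR D * INR (D + m))) 1 q).
{ induction q as [|q IH]; intros Hq.
  - rewrite sum_O, sum_n_m_zero by lia. change zero with 0.
    rewrite Nat.add_0_r, Nat.sub_0_r. unfold eps, D.
    rewrite (Nat.mul_comm (S p) k), Nat.Div0.mod_mul. rewrite Nat.eqb_refl, S_INR.
    R_eq. unfold Rdiv. ring.
  - rewrite sum_Sn, IH, sum_n_Sm by lia. change plus with Rplus.
    replace (eps (S p) (D + S q)) with (-1).
    2:{ unfold eps, D. rewrite (Nat.mul_comm (S p) k), Nat.add_comm, Nat.Div0.mod_add.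
        now rewrite Nat.mod_small by lia. }
    rewrite (plus_INR D). rewrite !minus_INR by lia. pose proof (pos_INR (S q)).
    rewrite !S_INR in *.
    R_eq. field. lra. }
rewrite E, Nat.sub_diag by lia. unfold Q. replace (S p - 1)%nat with p by lia.
fold D. change (INR 0) with 0. unfold Rdiv at 1. rewrite Rmult_0_l. apply Rplus_0_l.
Qed.

Lemma sum_n_Cmult_RtoC (q : C) (f : nat -> R) (n : nat) :
  sum_n (fun r => q * RtoC (f r))%C n = (q * RtoC (sum_n f n))%C.
Proof.
induction n as [|n IH]; [now rewrite !sum_O|].
rewrite !sum_Sn, IH. change plus with Cplus at 1. change plus with Rplus.
rewrite RtoC_plus. C_eq. ring.
Qed.

Lemma block_sum_C (c : nat -> C) (f : nat -> R) (p k : nat) :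
  sum_n (fun r => c ((S p * k + r) / S p)%nat * RtoC (f (S p * k + r)%nat))%C p =
  (c k * RtoC (sum_n (fun r => f (S p * k + r)%nat) p))%C.
Proof.
rewrite <- sum_n_Cmult_RtoC. apply sum_n_ext_loc. intros r Hr.
replace ((S p * k + r) / S p)%nat with k by (apply Nat.div_unique with r; lia).
reflexivity.
Qed.

Lemma eps_bound (p n : nat) : Rabs (eps (S p) n) <= INR (S p).
Proof.
unfold eps. pose proof (pos_INR p). rewrite S_INR.
destruct (_ =? _)%nat; apply Rabs_le; lra.
Qed.

(** The condition for ungrouping the second series: [c] is [O(sqrt j)] and [eps] is bounded, so the
    terms are [O(1 / sqrt j)]. *)
Lemma eps_term_tends_to_0 (c : nat -> C) (p : nat) :
  (forall j, Cmod (c j) <= 4 * sqrt (INR j)) ->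
  tends_to_0 (V := C_NormedModule)
    (fun j => c (j / S p)%nat * RtoC (eps (S p) j / INR j))%C.
Proof.
intros Hc.
apply is_lim_seq_incr_1.
apply is_lim_seq_le_le with (fun _ => 0) (fun n => 4 * INR (S p) * / sqrt (INR (S n))).
- intros n. split; [apply norm_ge_0|].
  change (Cmod (c (S n / S p)%nat * RtoC (eps (S p) (S n) / INR (S n)))
          <= 4 * INR (S p) * / sqrt (INR (S n))).
  pose proof (Hc (S n / S p)%nat) as H1. pose proof (eps_bound p (S n)) as H2.
  assert (H3 : sqrt (INR (S n / S p)) <= sqrt (INR (S n))).
  { apply sqrt_le_1_alt, le_INR. apply Nat.Div0.div_le_upper_bound. lia. }
  assert (Hx : 0 < INR (S n)) by (apply lt_0_INR; lia).
  assert (Hs : 0 < sqrt (INR (S n))) by now apply sqrt_lt_R0.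
  assert (Hi : 0 < / INR (S n)) by now apply Rinv_0_lt_compat.
  rewrite Cmod_mult, Cmod_R. unfold Rdiv.
  rewrite Rabs_mult, (Rabs_pos_eq (/ _)) by lra.
  apply Rle_trans with (4 * sqrt (INR (S n)) * (INR (S p) * / INR (S n))).
  + apply Rmult_le_compat; [apply Cmod_ge_0| |lra|].
    * apply Rmult_le_pos; [apply Rabs_pos|lra].
    * apply Rmult_le_compat_r; lra.
  + right. rewrite <- (sqrt_sqrt (INR (S n))) at 2 by lra. field. lra.
- apply is_lim_seq_const.
- replace (Finite 0) with (Rbar_mult (4 * INR (S p)) 0) by (simpl; f_equal; ring).
  apply is_lim_seq_scal_l.
  apply (is_lim_seq_incr_1 (fun n => / sqrt (INR n))), is_lim_seq_inv_sqrt.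
Qed.

(** * The two expansions of [gamma a b z] *)

Theorem theorem3 :
  forall (a b B : nat) (z : C) (c : nat -> C),
    (0 < a)%nat -> (0 < b)%nat -> (1 < B)%nat -> Cmod z <= 1 ->
    is_gen_seq a b B z c ->
    is_series (fun j : nat => (c (S j) * RtoC (Q (S j) B))%C) (gamma a b z) /\
    is_series (fun j : nat =>
        (c (S j / B)%nat * RtoC (eps B (S j) / INR (S j)))%C) (gamma a b z).
Proof.
(* With [B = S p], a block is the range [0..p] that [sum_n] runs over. *)
intros a b [|p] z c Ha Hb HB Hz Hc; [lia|].
destruct (gen_seq_rec a b p z c Ha Hb Hz Hc) as [Hc0 Hrec].
set (w := spread (RtoC 0) a b (fun n => z ^ n)%C) in Hrec.
assert (Hw : forall j, Cmod (w j) <= 1).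
{ intros j. unfold w, spread. destruct (andb _ _); [now apply Cpow_le_1|].
  rewrite Cmod_0. lra. }
pose proof (Cmod_rec_bound c w (S p) HB Hc0 Hw Hrec) as Hbound.
destruct (ex_series_log_gap c Hbound) as [l Hl].
assert (Hg : is_series (fun j => w j * RtoC (log_gap j))%C (gamma a b z)).
{ pose proof (is_series_spread (V := C_NormedModule) _ a b _ Ha
               (gamma_correct a b z Ha Hb Hz)) as H.
  apply is_series_ext with (2 := H). intros j. unfold w.
  rewrite (spread_map (RtoC 0) (RtoC 0) (fun j y => y * RtoC (log_gap j))%C)
    by (trivial; ring).
  unfold spread. destruct (andb _ _); [|reflexivity]. apply Cmult_comm. }
assert (HQ : is_series (fun k => c k * RtoC (Q k (S p)))%C (gamma a b z)).
(* Since [c j - w j = c (j / S p)], the grouped series has terms [c k] times a block sum of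
   [log_gap], and its sum is [l - gamma a b z]. Subtracting it from [l] leaves [gamma a b z]. *)
{ pose proof (is_series_group (V := C_NormedModule) _ p _
                (is_series_Cminus _ _ _ _ Hl Hg)) as H.
  apply is_series_ext_eq with (3 := is_series_Cminus _ _ _ _ Hl H); [|C_eq; ring].
  intros k.
  rewrite (sum_n_ext _ (fun r => c ((S p * k + r) / S p)%nat
                                 * RtoC (log_gap (S p * k + r)))%C).
  (* At [k = 0] the formula for [Q] fails, but [c 0 = 0] removes the term. *)
  - rewrite block_sum_C. destruct k as [|k]; [rewrite Hc0; C_eq; ring|].
    rewrite Q_log_gap, RtoC_minus by lia. C_eq. ring.
  - intros r. rewrite (Hrec (S p * k + r)%nat) at 1. C_eq. ring. }
split.
- apply (is_series_shift (V := C_NormedModule) (fun k => c k * RtoC (Q k (S p)))%C);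
    [|exact HQ].
  rewrite Hc0. apply Cmult_0_l.
- apply (is_series_shift (V := C_NormedModule)
           (fun j => c (j / S p)%nat * RtoC (eps (S p) j / INR j))%C).
  { rewrite Nat.Div0.div_0_l, Hc0. apply Cmult_0_l. }
  apply (is_series_ungroup (V := C_NormedModule) _ p).
  + now apply eps_term_tends_to_0.
  + apply is_series_ext with (2 := HQ). intros k.
    rewrite (block_sum_C c (fun j => eps (S p) j / INR j)).
    destruct k as [|k]; [rewrite Hc0; C_eq; ring|]. now rewrite Q_eps_block by lia.
Qed.
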